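(* A multi-agent system of $N$ agents in the plane, with positions $P_1(t),\dots,P_N(t)\in\mathbb{R}^2$ evolving under the dynamics $$\dot P_i=v_0\,(u_i^{+}+u_i^{-}),\qquad i=1,\dots,N,$$ ensures that pairs of neighboring agents at $t=0$ (i.e. agents at a distance less than $V$) remain neighbors forever: for every pair $i\neq j$, if $\|P_j(0)-P_i(0)\|<V$, then $\|P_j(t)-P_i(t)\|<V$ for all $t\ge 0$.
   Context: $V>0$ is the visibility range and $v_0>0$ is a constant. For agents $i,j$ located at $P_i,P_j\in\mathbb{R}^2$ define $$u_{ij}=\begin{cases}\dfrac{P_j-P_i}{\|P_j-P_i\|}, & 0<\|P_j-P_i\|\le V,\\[2mm] 0, & \|P_j-P_i\|=0\ \text{or}\ \|P_j-P_i\|>V.\end{cases}$$ The vectors $u_i^{+},u_i^{-}$ are determined by the current configuration as follows. Consider the nonzero vectors among $\{u_{ij}\}_{j=1,\dots,N}$. If there are none, $u_i^{+}=u_i^{-}=0$. Otherwise, anchor at $P_i$ a unit vector initially equal to one of these nonzero vectors and rotate it clockwise through a full circle. Its successive encounters with the nonzero $u_{ij}$'s define angles $\alpha_1,\dots,\alpha_r$ with $\alpha_1+\dots+\alpha_r=2\pi$, where $\alpha_k$ is the angle from the $k$-th to the $(k+1)$-th encounter and $\alpha_r$ is the angle from the last encounter to the first one again (if there is only one distinct direction, the full angle $2\pi$ is taken from that direction to itself). If none of these angles is bigger than $\pi$, set $u_i^{+}=u_i^{-}=0$ (the agent is ''surrounded'' and stays put). Otherwise let $\alpha_b>\pi$ be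 the angle bigger than $\pi$, and let $u_i^{+}$ and $u_i^{-}$ be the unit vectors $u_{ij}$ encountered when entering and when exiting the angle $\alpha_b$, respectively. In that case all visible neighbors of agent $i$ lie in a disk sector of angle less than $\pi$ bounded by the directions $u_i^{+}$ and $u_i^{-}$. Agents that collide (reach the same location) are assumed to merge and thereafter move as a single agent. *)

(* Defs.v *)
From HB Require Import structures.
From mathcomp Require Import all_boot all_order all_algebra.
From mathcomp Require Import all_classical all_reals all_analysis.

Set Implicit Arguments.
Unset Strict Implicit.
Unset Printing Implicit Defensive.

Import Order.TTheory GRing.Theory Num.Theory.
Import numFieldNormedType.Exports.
Local Open Scope classical_set_scope.
Local Open Scope ring_scope.

(* The library norm `|p| on row vectors is the sup norm, so the Euclidean norm
   has to be spelled out. *)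
Definition enorm (R : realType) (p : 'rV[R]_2) : R :=
  Num.sqrt (p 0 0 ^+ 2 + p 0 1 ^+ 2).

Definition dir (R : realType) (N : nat) (V : R) (P : 'I_N -> 'rV[R]_2)
    (i j : 'I_N) : 'rV[R]_2 :=
  if 0 < enorm (P j - P i) <= V
  then (enorm (P j - P i))^-1 *: (P j - P i) else 0.

Definition visible_dirs (R : realType) (N : nat) (V : R)
    (P : 'I_N -> 'rV[R]_2) (i : 'I_N) : seq 'rV[R]_2 :=
  [seq u <- [seq dir V P i j | j <- enum 'I_N] | u != 0].

Definition rot_cw (R : realType) (theta : R) (u : 'rV[R]_2) : 'rV[R]_2 :=
  \row_(k < 2) if k == 0 then u 0 0 * cos theta + u 0 1 * sin theta
               else - (u 0 0 * sin theta) + u 0 1 * cos theta.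

(* For unit vectors u and v exactly one angle satisfies the condition. *)
Definition cw_angle (R : realType) (u v : 'rV[R]_2) : R :=
  xget 0 [set theta | 0 <= theta < 2 * pi /\ rot_cw theta u = v].

(* The distinct directions of s in the order in which a unit vector meets them
   when it starts at the first entry of s and makes one clockwise turn; that
   first entry has angle 0, so it also comes first here. *)
Definition encounters (R : realType) (s : seq 'rV[R]_2) : seq 'rV[R]_2 :=
  sort (fun v w => cw_angle (head 0 s) v <= cw_angle (head 0 s) w) (undup s).

(* The angles alpha_1, ..., alpha_r between successive encounters.  The default
   value 2 * pi of nth closes the turn: the last angle runs from the last
   encounter back to the starting direction (and is 2 * pi when r = 1). *)
Definition turn_angles (R : realType) (s : seq 'rV[R]_2) : seq R :=
  let theta := [seq cw_angle (head 0 s) v | v <- encounters s] in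
  [seq nth (2 * pi) theta k.+1 - nth 0 theta k | k <- iota 0 (size theta)].

(* Index (from 0) of the angle bigger than pi, or the number of angles if there
   is none; the angles add up to 2 * pi, so at most one qualifies. *)
Definition big_angle (R : realType) (s : seq 'rV[R]_2) : nat :=
  find (fun a => pi < a) (turn_angles s).

Definition u_plus (R : realType) (N : nat) (V : R) (P : 'I_N -> 'rV[R]_2)
    (i : 'I_N) : 'rV[R]_2 :=
  let s := visible_dirs V P i in
  if has (fun a => pi < a) (turn_angles s)
  then nth 0 (encounters s) (big_angle s) else 0.

(* If the big angle is the last one, it is exited at the starting direction,
   which is the default value of nth. *)
Definition u_minus (R : realType) (N : nat) (V : R) (P : 'I_N -> 'rV[R]_2)
    (i : 'I_N) : 'rV[R]_2 :=
  let s := visible_dirs V P i in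
  if has (fun a => pi < a) (turn_angles s)
  then nth (head 0 s) (encounters s) (big_angle s).+1 else 0.

Definition abs_continuous (R : realType) (W : normedModType R) (a b : R)
    (f : R -> W) : Prop :=
  forall e : R, 0 < e -> exists2 d : R, 0 < d &
    forall (n : nat) (x y : nat -> R),
      (forall k, (k < n)%N -> a <= x k /\ x k <= y k /\ y k <= b) ->
      (forall k, (k.+1 < n)%N -> y k <= x k.+1) ->
      \sum_(k < n) (y k - x k) < d ->
      \sum_(k < n) `|f (y k) - f (x k)| < e.

(* The right-hand side is discontinuous in the configuration (agents come into
   view, agents meet), so in general no trajectory is differentiable at every
   time.  Solutions are taken in the sense of Caratheodory: locally absolutely
   continuous, with the equation holding at almost every time.  The last clause
   is the merging of colliding agents. *)
Definition trajectory (R : realType) (N : nat) (V v0 : R)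
    (P : 'I_N -> R -> 'rV[R]_2) : Prop :=
  [/\ forall (i : 'I_N) (T : R), 0 <= T -> abs_continuous 0 T (P i),
      {ae (@lebesgue_measure R), forall t : R, 0 < t -> forall i : 'I_N,
        is_derive t (1 : R) (P i)
          (v0 *: (u_plus V (P ^~ t) i + u_minus V (P ^~ t) i))} &
      forall (i j : 'I_N) (s t : R), 0 <= s -> s <= t ->
        P i s = P j s -> P i t = P j t].

(* Main.v *)
(* Write e for the unit vector from agent i towards a visible agent j, and theta
   for its clockwise angle.  The empty sector of angle > pi is bounded by the
   angles a and b of u_i^+ and u_i^-, and theta lies outside it, so
   <e, u_i^+ + u_i^-> = cos (theta - a) + cos (theta - b) >= 0: an agent never
   moves away from a visible neighbor.  Hence the squared distance of a pair
   has a nonpositive derivative at almost every time at which the pair is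
   visible; being absolutely continuous, it cannot increase, and the pair never
   reaches distance V. *)

Require Import Defs.
From HB Require Import structures.
From mathcomp Require Import all_boot all_order all_algebra.
From mathcomp Require Import all_classical all_reals all_analysis.
From mathcomp Require Import ring lra.
Import Order.TTheory GRing.Theory Num.Theory.
Import numFieldNormedType.Exports.
Local Open Scope ring_scope.

Set Implicit Arguments.
Unset Strict Implicit.
Unset Printing Implicit Defensive.

(** * The Euclidean dot product on the plane *)

Definition dot (R : realType) (u v : 'rV[R]_2) : R :=
  u 0 0 * v 0 0 + u 0 1 * v 0 1.

Lemma dotDr (R : realType) (u v w : 'rV[R]_2) :
  dot u (v + w) = dot u v + dot u w.
Proof. by rewrite /dot !mxE; ring. Qed.

Lemma dotZl (R : realType) (a : R) (u v : 'rV[R]_2) :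
  dot (a *: u) v = a * dot u v.
Proof. by rewrite /dot !mxE; ring. Qed.

Lemma dotZr (R : realType) (a : R) (u v : 'rV[R]_2) :
  dot u (a *: v) = a * dot u v.
Proof. by rewrite /dot !mxE; ring. Qed.

Lemma dotNl (R : realType) (u v : 'rV[R]_2) : dot (- u) v = - dot u v.
Proof. by rewrite /dot !mxE; ring. Qed.

Lemma dotNr (R : realType) (u v : 'rV[R]_2) : dot u (- v) = - dot u v.
Proof. by rewrite /dot !mxE; ring. Qed.

Lemma row2P (T : Type) (u v : 'rV[T]_2) :
  u 0 0 = v 0 0 -> u 0 1 = v 0 1 -> u = v.
Proof.
move=> e0 e1; apply/rowP; case=> [[|[|//]] ?].
  by rewrite (_ : Ordinal _ = 0)//; exact: val_inj.
by rewrite (_ : Ordinal _ = 1)//; exact: val_inj.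
Qed.

Lemma enormE (R : realType) (u : 'rV[R]_2) : enorm u = Num.sqrt (dot u u).
Proof. by rewrite /enorm /dot -!expr2. Qed.

Lemma dot_ge0 (R : realType) (u : 'rV[R]_2) : 0 <= dot u u.
Proof. by rewrite /dot -!expr2 addr_ge0 ?sqr_ge0. Qed.

Lemma enormN (R : realType) (u : 'rV[R]_2) : enorm (- u) = enorm u.
Proof. by rewrite !enormE dotNl dotNr opprK. Qed.

Lemma enorm_eq0 (R : realType) (u : 'rV[R]_2) : enorm u = 0 -> u = 0.
Proof.
rewrite enormE => /eqP; rewrite sqrtr_eq0 /dot -!expr2 => le0.
have [x2 y2] := (sqr_ge0 (u 0 0), sqr_ge0 (u 0 1)).
have /eqP : u 0 0 ^+ 2 = 0 by lra.
rewrite sqrf_eq0 => /eqP x0.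
have /eqP : u 0 1 ^+ 2 = 0 by lra.
rewrite sqrf_eq0 => /eqP y0.
by apply: row2P; rewrite mxE.
Qed.

(** * Clockwise angles between unit vectors *)

Lemma exists_angle (R : realType) (c s : R) : c ^+ 2 + s ^+ 2 = 1 ->
  exists2 theta, 0 <= theta < 2 * pi & cos theta = c /\ sin theta = s.
Proof.
move=> cs1; have pi0 := pi_gt0 R.
have s2 : s ^+ 2 = 1 - c ^+ 2 by rewrite -cs1; ring.
have cI : -1 <= c <= 1.
  by have := sqr_ge0 s; rewrite s2 => ?; apply/andP; split; nra.
have [a0 ap] := (acos_ge0 cI, acos_lepi cI).
have cosa : cos (acos c) = c by rewrite acosK// in_itv.
have sina := sin_acos cI; rewrite -s2 sqrtr_sqr in sina.
have [s0|s0] := leP 0 s.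
  by exists (acos c); [apply/andP; split; lra | rewrite sina ger0_norm].
(* For [s < 0] the witness is [2 * pi - acos c]; it is strictly below [2 * pi] only because the
   angle 0 is excluded. *)
have a_neq0 : acos c != 0.
  apply: contraTneq s0 => a0'; move: sina.
  by rewrite -leNgt a0' sin0 => /esym/normr0_eq0 ->.
have a_gt0 : 0 < acos c by rewrite lt_neqAle eq_sym a_neq0.
exists (- acos c + pi *+ 2); first by rewrite -mulr_natl; apply/andP; split; lra.
by rewrite cosD2pi sinD2pi cosN sinN cosa sina ltr0_norm// opprK.
Qed.

Lemma cw_angleP (R : realType) (u v : 'rV[R]_2) :
  dot u u = 1 -> dot v v = 1 ->
  0 <= cw_angle u v < 2 * pi /\ rot_cw (cw_angle u v) u = v.
Proof.
rewrite /dot => u1 v1.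
(* The cosine is the dot product and the sine the cross product, signed for clockwise rotation; by
   Lagrange's identity their squares add up to the product of the squared lengths. *)
have [|theta tI [ct st]] :=
    @exists_angle R (dot u v) (v 0 0 * u 0 1 - v 0 1 * u 0 0).
  have : (u 0 0 * u 0 0 + u 0 1 * u 0 1) * (v 0 0 * v 0 0 + v 0 1 * v 0 1) = 1.
    by rewrite u1 v1 mulr1.
  by move=> <-; rewrite /dot; ring.
suff: [set x | 0 <= x < 2 * pi /\ rot_cw x u = v]%classic theta.
  by move/(xgetI 0).
split => //; apply: row2P; rewrite mxE ct st /dot /=.
  by rewrite -[RHS]mul1r -u1; ring.
by rewrite -[RHS]mul1r -u1; ring.
Qed.

Lemma rot_cw2pi (R : realType) (u : 'rV[R]_2) : rot_cw (2 * pi) u = u.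
Proof.
by apply: row2P; rewrite mxE mulr_natl cos2pi sin2pi /=; ring.
Qed.

Lemma dot_rot_cw (R : realType) (a b : R) (u : 'rV[R]_2) :
  dot (rot_cw a u) (rot_cw b u) = cos (a - b) * dot u u.
Proof. by rewrite /dot !mxE /= cosB; ring. Qed.

(** * Velocity of an agent against the direction of a visible neighbor *)

Lemma cos_le0 (R : realType) (x : R) :
  pi / 2 <= x <= pi / 2 + pi -> cos x <= 0.
Proof.
move=> /andP[? ?]; rewrite -[x](subrK pi) cosDpi oppr_le0 cos_ge0_pihalf//.
by apply/andP; split; lra.
Qed.

(* With m the midpoint of [a, b] and h its half-length, the sum is
   2 cos (theta - m) cos h, and both cosines are nonpositive. *)
Lemma cosD_ge0_outside (R : realType) (a b theta : R) :
  0 <= a -> b <= 2 * pi -> pi < b - a -> 0 <= theta <= 2 * pi ->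
  theta <= a \/ b <= theta -> 0 <= cos (theta - a) + cos (theta - b).
Proof.
move=> a0 b2 ab /andP[t0 t2] tab; have pi0 := pi_gt0 R.
pose m := (a + b) / 2; pose h := (b - a) / 2.
have -> : theta - a = (theta - m) + h by rewrite /m /h; field.
have -> : theta - b = (theta - m) - h by rewrite /m /h; field.
rewrite cosD [X in _ + X]cosB addrACA addNr addr0 -mulr2n.
have ch : cos h <= 0 by apply: cos_le0; rewrite /h; apply/andP; split; lra.
have cm : cos (theta - m) <= 0.
  case: tab => tab; last by apply: cos_le0; rewrite /m; apply/andP; split; lra.
  by rewrite -cosN; apply: cos_le0; rewrite /m; apply/andP; split; lra.
by rewrite mulrn_wge0// mulr_le0.
Qed.

(** Every entry of [s] is [head 0 s] rotated by its clockwise angle, so dot products become cosines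
    of angle differences and [cosD_ge0_outside] applies. *)
Lemma dot_big_angle_ge0 (R : realType) (s : seq 'rV[R]_2) (v : 'rV[R]_2) :
  (forall w, w \in s -> dot w w = 1) -> v \in s ->
  has (fun a => pi < a) (turn_angles s) ->
  0 <= dot v (nth 0 (encounters s) (big_angle s) +
              nth (head 0 s) (encounters s) (big_angle s).+1).
Proof.
move=> s1 vs hs; pose b := big_angle s; rewrite -/b.
pose ang := cw_angle (head 0 s).
have h_s : head 0 s \in s by case: (s) vs => //= x s' _; exact: mem_head.
have h1 := s1 _ h_s.
have encE w : (w \in encounters s) = (w \in s) by rewrite mem_sort mem_undup.
have angP w : w \in s -> 0 <= ang w < 2 * pi /\ rot_cw (ang w) (head 0 s) = w.
  by move=> ws; apply: cw_angleP => //; exact: s1.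
have lt_b : (b < size (encounters s))%N.
  by move: hs; rewrite has_find size_map size_iota size_map.
have big : pi < nth (2 * pi) (map ang (encounters s)) b.+1
                - nth 0 (map ang (encounters s)) b.
  have := nth_find 0 hs; rewrite -/b.
  by rewrite (nth_map 0%N) ?size_iota ?size_map// nth_iota ?size_map.
rewrite [X in _ - X](nth_map 0)// in big.
have srt k l : (l < size (encounters s))%N -> (k <= l)%N ->
    ang (nth 0 (encounters s) k) <= ang (nth 0 (encounters s) l).
  move=> ln kl.
  have tot : total (fun v w => ang v <= ang w) by move=> x y; exact: le_total.
  have tr : transitive (fun v w => ang v <= ang w).
    by move=> y x z; exact: le_trans.
  apply: (sorted_leq_nth tr _ 0 (sort_sorted tot _)) => //.
  by rewrite inE; exact: leq_ltn_trans kl ln.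
have nth_s k : (k < size (encounters s))%N -> nth 0 (encounters s) k \in s.
  by move=> kn; rewrite -encE mem_nth.
(* If the big angle is the last one, [B] is the default [2 * pi] and [e] the default [head 0 s];
   they match because a full turn is the identity. *)
set e := nth (head 0 s) _ _.
set B := nth (2 * pi) _ _ in big.
have [B2 eB] : B <= 2 * pi /\ rot_cw B (head 0 s) = e.
  rewrite /B /e; have [lt|ge] := ltnP b.+1 (size (encounters s)).
    rewrite (nth_map 0)// (set_nth_default 0 (head 0 s))//.
    by have [/andP[_ /ltW]] := angP _ (nth_s _ lt).
  by rewrite !nth_default ?size_map// rot_cw2pi.
have [/andP[A0 _] eA] := angP _ (nth_s _ lt_b).
have [/andP[v0 v2] ev] := angP _ vs.
(* The encounters are sorted by angle, and the index of [v] is either at most [b] or at least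
   [b.+1]. *)
have out : ang v <= ang (nth 0 (encounters s) b) \/ B <= ang v.
  have vE : v \in encounters s by rewrite encE.
  have ltv : (index v (encounters s) < size (encounters s))%N by rewrite index_mem.
  have [vb|bv] := leqP (index v (encounters s)) b; [left|right].
    by rewrite -{1}(nth_index 0 vE); apply: srt.
  rewrite /B (nth_map 0) ?(leq_ltn_trans bv)// -(nth_index 0 vE).
  exact: srt.
rewrite dotDr -{1}eA -eB -ev !dot_rot_cw h1 !mulr1.
by apply: cosD_ge0_outside => //; rewrite v0 ltW.
Qed.

Lemma dir_unit (R : realType) (N : nat) (V : R) (P : 'I_N -> 'rV[R]_2)
    (i j : 'I_N) : dir V P i j != 0 -> dot (dir V P i j) (dir V P i j) = 1.
Proof.
rewrite /dir; case: ifP => [/andP[d0 _] _|_]; last by rewrite eqxx.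
rewrite dotZl dotZr mulrA -expr2 -(sqr_sqrtr (dot_ge0 (P j - P i))) -enormE.
by rewrite -exprMn mulVf ?expr1n// gt_eqF.
Qed.

Lemma dot_dir_velocity_ge0 (R : realType) (N : nat) (V : R)
    (P : 'I_N -> 'rV[R]_2) (i j : 'I_N) :
  0 <= dot (dir V P i j) (u_plus V P i + u_minus V P i).
Proof.
have [->|dij] := eqVneq (dir V P i j) 0.
  by rewrite /dot !mxE !mul0r addr0.
rewrite /u_plus /u_minus; case: ifP => hs; last first.
  by rewrite addr0 /dot !mxE !mulr0 addr0.
apply: dot_big_angle_ge0 => //.
  by move=> w; rewrite mem_filter => /andP[w0 /mapP[k _ wE]]; rewrite wE dir_unit -?wE.
by rewrite mem_filter dij; apply/mapP; exists j => //; rewrite mem_enum.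
Qed.

(** Visibility is symmetric: [P j - P i] is a nonnegative multiple of [dir V P i j] and of
    [- dir V P j i], so each agent's own velocity contributes a nonpositive term. *)
Lemma dot_relative_velocity_le0 (R : realType) (N : nat) (V : R)
    (P : 'I_N -> 'rV[R]_2) (i j : 'I_N) : enorm (P j - P i) <= V ->
  dot (P j - P i) ((u_plus V P j + u_minus V P j) -
                   (u_plus V P i + u_minus V P i)) <= 0.
Proof.
move=> dV; have [d0|d_neq0] := eqVneq (enorm (P j - P i)) 0.
  by rewrite (enorm_eq0 d0) /dot !mxE !mul0r addr0.
have d0 : 0 < enorm (P j - P i).
  by rewrite lt_neqAle eq_sym d_neq0 enormE sqrtr_ge0.
have dE (k l : 'I_N) : enorm (P l - P k) = enorm (P j - P i) ->
    P l - P k = enorm (P j - P i) *: dir V P k l.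
  by move=> e; rewrite /dir e d0 dV/= scalerA divff ?scale1r// gt_eqF.
have ij := dE i j erefl.
have ji : P j - P i = - (enorm (P j - P i) *: dir V P j i).
  by rewrite -dE ?opprB// -enormN opprB.
rewrite dotDr dotNr [X in dot X _ + _]ji [X in _ - dot X _]ij dotNl !dotZl.
by rewrite -opprD oppr_le0 addr_ge0// mulr_ge0 ?dot_dir_velocity_ge0// ltW.
Qed.

(** * Monotonicity from the sign of the derivative almost everywhere *)

(** Letting the step jump across [t], from any nearby [x] before it to any nearby [y] after it,
    treats limits and continuation at once. The step is applied at the supremum of the points
    reached. *)
Lemma interval_induction (R : realType) (a b : R) (S : R -> Prop) :
  a <= b -> S a ->
  (forall t, a <= t <= b -> exists2 h, 0 < h & forall x y,
     a <= x -> x <= t -> t <= y -> y <= b -> t - h < x -> y < t + h ->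
     S x -> S y) ->
  S b.
Proof.
move=> ab Sa step; pose E := [set c | a <= c <= b /\ S c]%classic.
have Ea : E a by rewrite /E /= lexx ab.
have ubE : ubound E b by move=> x [/andP[]].
have supE : has_sup E by split; [exists a | exists b].
have ac : a <= sup E by apply: ub_le_sup => //; exists b.
have cb : sup E <= b by apply: ge_sup => //; exists a.
have [|h h0 hS] := step (sup E); first by rewrite ac cb.
have [x [/andP[ax xb] Sx] hx] := sup_adherent h0 supE.
have xc : x <= sup E by apply: ub_le_sup; [exists b | split => //; rewrite ax xb].
have [bh|hb] := ltP b (sup E + h).
  by apply: hS Sx; rewrite ?lexx.
have Sy : S (sup E + h / 2) by apply: hS Sx => //; lra.
have : sup E + h / 2 <= sup E.
  by apply: ub_le_sup; [exists b | split => //; apply/andP; split; lra].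
lra.
Qed.

(** Near [t] the difference quotients based at [t] are at most [d + r <= r]; the increments over
    [[x, t]] and [[t, y]] then add up. *)
Lemma derive_straddle (R : realType) (f : R -> R) (t d r : R) :
  is_derive t (1 : R) f d -> d <= 0 -> 0 < r ->
  exists2 h, 0 < h & forall x y,
    x <= t -> t <= y -> t - h < x -> y < t + h -> f y - f x <= r * (y - x).
Proof.
move=> [df dE] d0 r0.
have := df; rewrite /derivable => /cvg_ex[l fl].
have ld : l = d by rewrite -dE; apply/esym/cvg_lim.
move/cvgrPdist_le : fl => /(_ r r0)[/= h h0 hh]; rewrite ld in hh.
exists h => // x y xt ty hx hy.
have near s : s != t -> `|s - t| < h -> `|d - (s - t)^-1 * (f s - f t)| <= r.
  move=> st sh; have := hh (s - t); rewrite /= sub0r normrN subr_eq0 => /(_ sh st).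
  by rewrite /GRing.scale /= mulr1 subrK.
have fy : f y - f t <= r * (y - t).
  have [->|yt] := eqVneq y t; first by rewrite !subrr mulr0.
  have {}ty : 0 < y - t by rewrite subr_gt0 lt_neqAle eq_sym yt.
  have /ler_normlP[+ _] : `|d - (y - t)^-1 * (f y - f t)| <= r.
    by apply: near; rewrite ?ger0_norm; lra.
  by rewrite opprB => le; rewrite [leRHS]mulrC -ler_pdivrMl//; lra.
have fx : f t - f x <= r * (t - x).
  have [->|xt'] := eqVneq x t; first by rewrite !subrr mulr0.
  have {}xt : 0 < t - x by rewrite subr_gt0 lt_neqAle xt'.
  have /ler_normlP[+ _] : `|d - (x - t)^-1 * (f x - f t)| <= r.
    by apply: near; rewrite ?ler0_norm; lra.
  rewrite opprB -[x - t]opprB -[f x - f t]opprB invrN mulrNN => le.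
  by rewrite [leRHS]mulrC -ler_pdivrMl//; lra.
lra.
Qed.

Lemma negligible_open_cover (R : realType) (E : set R) (d : R) :
  (@lebesgue_measure R).-negligible E -> 0 < d ->
  exists U : set R, [/\ open U, (E `<=` U)%classic & (lebesgue_measure U < d%:E)%E].
Proof.
move=> [A [mA A0 EA]] d0.
have [|U [oU AU mU]] := lebesgue_regularity_outer mA _ d0.
  by rewrite [ltLHS](_ : _ = 0%E) ?ltry.
exists U; split => //; first exact: subset_trans AU.
rewrite -(setDUK AU) measureU//.
- by rewrite [X in (X + _)%E](_ : _ = 0%E) ?add0e.
- by apply: measurableD => //; exact: measurable_realfun.open_measurable.
- by rewrite setDIK.
Qed.

(** Bookkeeping for the covering argument: each new piece inside [U] is paid for by the growth of
    the measure of [U] to the left of the current point. *)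
Lemma lebesgue_measureU_itv (R : realType) (U : set R) (x y : R) : x <= y ->
  measurable U -> (`]x, y] `<=` U)%classic ->
  (lebesgue_measure (U `&` `]-oo, x]) + (y - x)%:E <=
   lebesgue_measure (U `&` `]-oo, y]))%E%classic.
Proof.
move=> xy mU xyU.
have sub : (U `&` `]-oo, x] `|` `]x, y] `<=` U `&` `]-oo, y])%classic.
  move=> z [[Uz zx]|zxy]; split; [exact: Uz| |exact: xyU|].
    by move: zx; rewrite /= !in_itv /= => /le_trans; apply.
  by move: zxy; rewrite /= !in_itv /= => /andP[].
have disj : (U `&` `]-oo, x] `&` `]x, y] = set0)%classic.
  apply/seteqP; split => // z [[_]]; rewrite /= !in_itv /= => zx /andP[xz _].
  by move: (lt_le_trans xz zx); rewrite ltxx.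
have <- : lebesgue_measure (`]x, y]%classic : set R) = (y - x)%:E.
  rewrite lebesgue_measure_itv /= lte_fin; case: ltP => // yx.
  by rewrite (_ : y = x) ?subrr//; apply/eqP; rewrite eq_le yx xy.
rewrite -measureU//; last exact: measurableI.
apply: le_measure; rewrite ?inE//; last exact: measurableI.
by apply: measurableU => //; exact: measurableI.
Qed.

(* The null set where the derivative is not controlled is covered by an open U
   of small measure.  Interval induction cuts [a, b] into finitely many pieces:
   on those around a point outside U the increment is at most r times the
   length, and those around a point of U lie in U, so that absolute continuity
   makes the sum of their increments small. *)
Lemma abs_continuous_le (R : realType) (a b : R) (f : R -> R) : a <= b ->
  abs_continuous a b f ->
  {ae (@lebesgue_measure R), forall t : R, a < t < b ->
     exists2 d, d <= 0 & is_derive t (1 : R) f d} ->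
  f b <= f a.
Proof.
move=> ab acf aef; apply/ler_addgt0Pr => e e0.
have e2 : 0 < e / 2 by rewrite divr_gt0.
have [d d0 acd] := acf _ e2.
(* The slope [r] costs at most [e / 2] over [[a, b]]; the added 1 keeps the denominator positive
   when [a = b]. *)
pose r := e / 2 / (b - a + 1).
have r0 : 0 < r by rewrite divr_gt0// ltr_wpDl// subr_ge0.
have rba : r * (b - a) <= e / 2.
  by rewrite /r mulrAC ler_pdivrMr ?ler_pM2l ?lerDl// ltr_wpDl// subr_ge0.
(* The derivative is controlled only inside []a, b[], so the endpoints join the exceptional set. *)
have nab : (@lebesgue_measure R).-negligible [set a; b]%classic.
  by apply: negligibleU; apply/negligibleP => //; exact: lebesgue_measure_set1.
have [U [oU EU mU]] := negligible_open_cover (negligibleU aef nab) d0.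
have mUU : measurable U by exact: measurable_realfun.open_measurable.
(* Only the pieces inside [U] are recorded. Bounding their total length by the measure of [U] up to
   [c] lets the bound be extended piece by piece while staying below [d]. *)
pose good c := exists n (x y : nat -> R), [/\
  forall k, (k < n)%N -> a <= x k /\ x k <= y k /\ y k <= c,
  forall k, (k.+1 < n)%N -> y k <= x k.+1,
  ((\sum_(k < n) (y k - x k))%:E <=
     lebesgue_measure (U `&` `]-oo, c]%classic)%classic)%E &
  f c - f a <= r * (c - a) + \sum_(k < n) `|f (y k) - f (x k)|].
suff [n [x [y [xy yx sm le]]]] : good b.
  have sd : \sum_(k < n) (y k - x k) < d.
    rewrite -lte_fin (le_lt_trans sm)// (le_lt_trans _ mU)//.
    by apply: le_measure; rewrite ?inE//; exact: measurableI.
  have := acd n x y xy yx sd; lra.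
apply: (interval_induction ab).
  by exists 0%N, (fun=> 0), (fun=> 0); split => //; rewrite !big_ord0 ?subrr ?mulr0 ?addr0.
move=> t /andP[at_ tb]; have [Ut|nUt] := pselect (U t).
  have [h /= h0 hU] := (nbhs_ballP _ _).1 (open_nbhs_nbhs (conj oU Ut)).
  exists h => // p q ap pt tq qb hp hq [n [x [y [xy yx sm le]]]].
  have pq := le_trans pt tq.
  pose x' k := if (k < n)%N then x k else p.
  pose y' k := if (k < n)%N then y k else q.
  have sumE (F : R -> R -> R) : \sum_(k < n.+1) F (y' k) (x' k) =
      \sum_(k < n) F (y k) (x k) + F q p.
    rewrite big_ord_recr /= /x' /y' ltnn; congr (_ + _).
    by apply: eq_bigr => k _; rewrite ltn_ord.
  exists n.+1, x', y'; split.
  - move=> k _; rewrite /x' /y'; case: ifP => // kn.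
    by have [? [? ?]] := xy k kn; split => //; split => //; lra.
  - move=> k; rewrite ltnS => kn; rewrite /x' /y' kn; case: ifP => [|_].
      exact: yx.
    by have [_ [_]] := xy k kn.
  - rewrite (sumE (fun u v => u - v)) EFinD.
    apply: le_trans (lebesgue_measureU_itv pq mUU _).
      by rewrite leeD2r.
    move=> z; rewrite /= in_itv /= => /andP[pz zq]; apply: hU.
    by rewrite /ball /= ltr_norml; apply/andP; split; lra.
  - rewrite (sumE (fun u v => `|f u - f v|)).
    have := ler_norm (f q - f p).
    have := mulr_ge0 (ltW r0) (_ : 0 <= q - p); rewrite subr_ge0 => /(_ pq).
    lra.
have tE : a < t < b /\ exists2 d, d <= 0 & is_derive t (1 : R) f d.
  have nt : t != a by apply/eqP => ta; apply: nUt; apply: EU; right; left.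
  have nt' : t != b by apply/eqP => ta; apply: nUt; apply: EU; right; right.
  have tab : a < t < b by rewrite !lt_neqAle at_ tb nt' eq_sym nt.
  split => //; apply: contrapT => nd; apply: nUt; apply: EU; left => /= H.
  exact/nd/H.
have [d' d'0 fd'] := tE.2.
have [h h0 hf] := derive_straddle fd' d'0 r0.
exists h => // p q ap pt tq qb hp hq [n [x [y [xy yx sm le]]]].
have pq := le_trans pt tq.
exists n, x, y; split => //.
- by move=> k /xy[? [? ?]]; split => //; split => //; lra.
- apply: (le_trans sm); apply: le_measure; rewrite ?inE; try exact: measurableI.
  by apply: setIS => z; rewrite /= !in_itv /= => /le_trans; apply.
- by have := hf p q pt tq hp hq; lra.
Qed.

(** * Absolute continuity and derivative of the squared distance *)

Lemma subrACA (G : zmodType) : @interchange G (fun x y => x - y) (fun x y => x - y).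
Proof. by move=> a b c d; rewrite opprD addrACA -opprD. Qed.

Lemma abs_continuous_near (R : realType) (W : normedModType R) (a b t e : R)
    (f : R -> W) : abs_continuous a b f -> a <= t <= b -> 0 < e ->
  exists2 h, 0 < h & forall s, a <= s <= b -> `|s - t| < h -> `|f s - f t| < e.
Proof.
move=> acf /andP[at_ tb] e0; have [d d0 hd] := acf e e0; exists d => // s /andP[as_ sb] st.
have {}hd x y : a <= x -> x <= y -> y <= b -> y - x < d -> `|f y - f x| < e.
  move=> ax xy yb yx; have := hd 1%N (fun=> x) (fun=> y).
  by rewrite !big_ord1; apply.
have [ts|/ltW ts] := leP t s; first by apply: hd => //; apply: le_lt_trans st; exact: ler_norm.
by rewrite distrC; apply: hd => //; apply: le_lt_trans st; rewrite distrC ler_norm.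
Qed.

(** Lets the squared distance of a pair inherit absolute continuity from the two positions. *)
Lemma abs_continuous_dominated (R : realType) (W W' : normedModType R)
    (a b C : R) (f : R -> W) (g h : R -> W') : 0 < C ->
  abs_continuous a b g -> abs_continuous a b h ->
  (forall x y, a <= x -> x <= y -> y <= b ->
    `|f y - f x| <= C * (`|g y - g x| + `|h y - h x|)) ->
  abs_continuous a b f.
Proof.
move=> C0 acg ach le e e0.
have e2 : 0 < e / (2 * C) by rewrite divr_gt0// mulr_gt0.
have [[d d0 hd] [d' d'0 hd']] := (acg _ e2, ach _ e2).
exists (Num.min d d'); first by rewrite lt_min d0.
move=> n x y xy yx; rewrite lt_min => /andP[/(hd n x y xy yx) sg /(hd' n x y xy yx) sh].
apply: (@le_lt_trans _ _ (\sum_(k < n) C * (`|g (y k) - g (x k)| + `|h (y k) - h (x k)|))).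
  by apply: ler_sum => k _; have [? [? ?]] := xy k (ltn_ord k); exact: le.
rewrite -mulr_sumr big_split /= -ltr_pdivlMl// (lt_le_trans (ltrD sg sh))//.
by rewrite le_eqVlt; apply/orP; left; apply/eqP; field; exact: lt0r_neq0.
Qed.

Lemma mx_coord_norm_le (R : realType) (u : 'rV[R]_2) (k : 'I_2) :
  `|u 0 k| <= `|u|.
Proof.
by rewrite [leRHS]/Num.Def.normr/= mx_normrE; exact: (le_bigmax _ _ (0, k)).
Qed.

(** Each coordinate contributes a difference of squares, whose sum factor is at most [2 * V]; the
    two coordinates together give [4 * V]. *)
Lemma dot_sqB_le (R : realType) (V : R) (p q : 'rV[R]_2) :
  0 < V -> dot p p <= V ^+ 2 -> dot q q <= V ^+ 2 ->
  `|dot q q - dot p p| <= 4 * V * `|q - p|.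
Proof.
move=> V0 pV qV.
have coord (u : 'rV[R]_2) k : dot u u <= V ^+ 2 -> `|u 0 k| <= V.
  move=> uV; rewrite -ler_sqr ?nnegrE ?(ltW V0)// real_normK ?num_real//.
  apply: le_trans uV; rewrite /dot -!expr2.
  have := sqr_ge0 (u 0 0); have := sqr_ge0 (u 0 1).
  case: k => [[|[|//]] ?].
    by rewrite (_ : Ordinal _ = 0); [lra | exact: val_inj].
  by rewrite (_ : Ordinal _ = 1); [lra | exact: val_inj].
have step k : `|(q 0 k - p 0 k) * (q 0 k + p 0 k)| <= `|q - p| * (2 * V).
  rewrite normrM ler_pM//.
    by have := mx_coord_norm_le (q - p) k; rewrite !mxE.
  by rewrite (le_trans (ler_normD _ _))// mulr_natl mulr2n lerD// coord.
have -> : dot q q - dot p p = (q 0 0 - p 0 0) * (q 0 0 + p 0 0) +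
                              (q 0 1 - p 0 1) * (q 0 1 + p 0 1).
  by rewrite /dot; ring.
rewrite (le_trans (ler_normD _ _))// (le_trans (lerD (step 0) (step 1)))//.
by lra.
Qed.

Lemma is_derive_dot (R : realType) (p : R -> 'rV[R]_2) (t : R) (dp : 'rV[R]_2) :
  is_derive t (1 : R) p dp ->
  is_derive t (1 : R) (fun s => dot (p s) (p s)) (2 * dot (p t) dp).
Proof.
move=> [dvp dpE].
have Dk k : is_derive t (1 : R) (fun s => p s 0 k) (dp 0 k).
  have /derivable_mxP dvk := dvp.
  by split; [exact: dvk | rewrite -dpE derive_mx// mxE].
have := is_deriveD (is_deriveM (Dk 0) (Dk 0)) (is_deriveM (Dk 1) (Dk 1)).
move=> /is_derive_eq; apply.
by rewrite /dot /GRing.scale /=; ring.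
Qed.

(* Visible neighbors of an agent make an angle of at most pi / 2 with its
   velocity, so the squared distance of a visible pair does not increase. *)
Lemma trajectory_dot_le (R : realType) (N : nat) (V v0 : R)
    (P : 'I_N -> R -> 'rV[R]_2) (i j : 'I_N) (T : R) :
  0 < V -> 0 < v0 -> trajectory V v0 P -> 0 <= T ->
  (forall s, 0 <= s <= T ->
     dot (P j s - P i s) (P j s - P i s) <= V ^+ 2) ->
  dot (P j T - P i T) (P j T - P i T) <= dot (P j 0 - P i 0) (P j 0 - P i 0).
Proof.
move=> V0 v00 [acP aeP _] T0 le.
apply: (abs_continuous_le (f := fun s => dot (P j s - P i s) (P j s - P i s)) T0).
  apply: (abs_continuous_dominated (C := 4 * V) _ (acP j T T0) (acP i T T0)).
    by rewrite mulr_gt0.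
  move=> x y x0 xy yT.
  apply: (le_trans (dot_sqB_le V0 (le x _) (le y _))).
  - by rewrite x0 (le_trans xy).
  - by rewrite (le_trans x0 xy).
  rewrite ler_pM2l ?mulr_gt0//.
  by rewrite subrACA; exact: ler_normB.
apply: (negligibleS _ aeP); apply: subsetC => t ODE /andP[t0 tT].
have [dPj dPi] := (ODE t0 j, ODE t0 i).
eexists; last exact: is_derive_dot (is_deriveB dPj dPi).
rewrite -scalerBr dotZr mulrCA pmulr_rle0// pmulr_rle0//.
apply: (@dot_relative_velocity_le0 R N V (P ^~ t)).
rewrite enormE -[leRHS](ger0_norm (ltW V0)) -sqrtr_sqr ler_wsqrtr// le//.
by rewrite !ltW.
Qed.

(** * Keeping a pair below the visibility range *)

Lemma continuous_dot_sq (R : realType) :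
  continuous (fun u : 'rV[R]_2 => dot u u).
Proof.
move=> u; have c k : ((fun v : 'rV[R]_2 => v 0 k) v @[v --> u] --> u 0 k)%classic.
  exact: coord_continuous.
exact: (cvgD (cvgM (c 0) (c 0)) (cvgM (c 1) (c 1))).
Qed.

Lemma abs_continuous_open (R : realType) (W : normedModType R) (a b t : R)
    (f g : R -> W) (A : set W) :
  abs_continuous a b f -> abs_continuous a b g -> a <= t <= b ->
  nbhs (g t - f t) A ->
  exists2 h, 0 < h & forall s, a <= s <= b -> `|s - t| < h -> A (g s - f s).
Proof.
move=> acf acg tI /nbhs_ballP[e /= e0 eA].
have e2 : 0 < e / 2 by rewrite divr_gt0.
have [h h0 hf] := abs_continuous_near acf tI e2.
have [h' h'0 hg] := abs_continuous_near acg tI e2.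
exists (Num.min h h'); first by rewrite lt_min h0.
move=> s sI; rewrite lt_min => /andP[/(hf s sI) fs /(hg s sI) gs].
apply: eA; rewrite -ball_normE /ball_ /= distrC.
by rewrite subrACA (le_lt_trans (ler_normB _ _))// [e]splitr ltrD.
Qed.

Unset Implicit Arguments.

Theorem theorem2p1p1 (R : realType) (N : nat) (V v0 : R)
    (P : 'I_N -> R -> 'rV[R]_2) (V_gt0 : 0 < V) (v0_gt0 : 0 < v0)
    (trajP : trajectory V v0 P) (i j : 'I_N) (neq_ij : i <> j)
    (neighbors0 : enorm (P j 0 - P i 0) < V) (t : R) (t_ge0 : 0 <= t) :
  enorm (P j t - P i t) < V.
Proof.
pose g s := dot (P j s - P i s) (P j s - P i s).
have gV s : (enorm (P j s - P i s) < V) = (g s < V ^+ 2).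
  rewrite enormE -[in LHS](ger0_norm (ltW V_gt0)) -sqrtr_sqr.
  by rewrite ltr_sqrt// exprn_gt0.
rewrite gV in neighbors0; rewrite gV.
have [acP _ _] := trajP.
(* The induction carries the bound by [g 0], which, unlike [g s < V ^+ 2], is a closed condition and
   survives limits. *)
suff gle : forall s, 0 <= s <= t -> g s <= g 0.
  by apply: le_lt_trans neighbors0; apply: gle; rewrite t_ge0 lexx.
apply: (interval_induction (S := fun c => forall s, 0 <= s <= c -> g s <= g 0) t_ge0).
  by move=> s; rewrite -eq_le => /eqP <-.
move=> c cI; have [gc|gc] := ltP (g c) (V ^+ 2).
  have nb : nbhs (P j c - P i c) [set u : 'rV[R]_2 | dot u u < V ^+ 2]%classic.
    exact: (cvgr_lt _ (@continuous_dot_sq R _) _ gc).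
  have [h h0 hg] := abs_continuous_open (acP i t t_ge0) (acP j t t_ge0) cI nb.
  exists h => // x y x0 xc cy yt hx hy Sx s /andP[s0 sy].
  (* Visibility is needed on all of [[0, s]]: up to [x] it comes from the induction hypothesis,
     after [x] from continuity near [c]. *)
  apply: (trajectory_dot_le V_gt0 v0_gt0 trajP s0) => r /andP[r0 rs].
  have [rx|xr] := leP r x.
    by apply/ltW/(le_lt_trans _ neighbors0)/Sx; rewrite r0.
  apply/ltW/hg; first by rewrite r0 (le_trans rs)// (le_trans sy).
  by rewrite ltr_norml; apply/andP; split; lra.
(* If [g c] had reached [V ^+ 2], then [g] would exceed [g 0] at all times near [c], in particular
   at [x], against the induction hypothesis. *)
have nb : nbhs (P j c - P i c) [set u : 'rV[R]_2 | g 0 < dot u u]%classic.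
  exact: (cvgr_gt _ (@continuous_dot_sq R _) _ (lt_le_trans neighbors0 gc)).
have [h h0 hg] := abs_continuous_open (acP i t t_ge0) (acP j t t_ge0) cI nb.
exists h => // x y x0 xc cy yt hx hy Sx; exfalso.
have : g x <= g 0 by apply: Sx; rewrite x0 lexx.
rewrite leNgt => /negP; apply; apply: hg; first by rewrite x0 (le_trans xc)// (le_trans cy).
by rewrite ltr_norml; apply/andP; split; lra.
Qed.
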